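(* Let $K,L$ be finite simplicial complexes, $G$ an abelian group and $f\colon K\to L$ a non-degenerate simplicial map. Then $f$ induces homomorphisms of homeology groups $$f_*\colon\mathcal{H}_{*,*}(K;G)\to\mathcal{H}_{*,*}(L;G),\qquad f_*\colon\widetilde{\mathcal{H}}_{*,*}(K;G)\to\widetilde{\mathcal{H}}_{*,*}(L;G),$$ and, dually, homomorphisms of cohomeology groups $$f^*\colon\mathcal{H}^{*,*}(L;G)\to\mathcal{H}^{*,*}(K;G),\qquad f^*\colon\widetilde{\mathcal{H}}^{*,*}(L;G)\to\widetilde{\mathcal{H}}^{*,*}(K;G).$$
   Context: A (finite, abstract) simplicial complex $K$ with finite vertex set $S$ is a collection of subsets of $S$ (simplices) containing every $\{v\}$, $v\in S$, and closed under passing to subsets; in particular $\varnothing\in K$. $|\sigma|$ denotes the cardinality of $\sigma$ and $\dim\sigma=|\sigma|-1$. A simplicial map $f\colon K\to L$ is non-degenerate if $|f(\sigma)|=|\sigma|$ for every simplex $\sigma\in K$. $C_n(K)=C^n(K)$ ($n\ge 0$) is the group of oriented simplicial $n$-chains: generated by ordered sequences $(v_0,\dots,v_n)$ of vertices, alternating in the entries, and zero if an entry is repeated or $\{v_0,\dots,v_n\}\notin K$. $C_{-1}(K)=\mathbb{Z}$ is generated by $(\varnothing)$. $C_*(K)=C^*(K)=\bigoplus_{k\ge0}C_k(K)$ carries the usual simplicial boundary $d$ (zero on $C_0$) and the coboundary $\delta(v_0,\dots,v_k)=\sum_{v\in S}(v,v_0,\dots,v_k)$. $\widetilde C_*(K)=\widetilde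 C^*(K)=\bigoplus_{k\ge-1}C_k(K)$ carries the same operators with $d(v)=(\varnothing)$ and $\delta(\varnothing)=\sum_{v\in S}(v)$. $N^{p,q}(K)\subset C_p(K)\otimes C^q(K)$ is the subgroup generated by all $\sigma\otimes\tau$ with $\sigma\subset\tau$, with differential $\Delta(\sigma\otimes\tau)=(d\sigma)\otimes\tau+(-1)^{|\sigma|}\sigma\otimes(\delta\tau)$, and total complex $T^n(N(K))=\bigoplus_{q-p=n}N^{p,q}(K)$. $\widetilde N^{p,q}(K)\subset\widetilde C_p(K)\otimes\widetilde C^q(K)$ is defined in the same way from the reduced complexes. $N_{p,q}(K)=\mathrm{Hom}(N^{p,q}(K),\mathbb{Z})$ with the dual differential $D=\Delta^*$ (its dual basis elements are again written $\sigma\otimes\tau$), and likewise $\widetilde N_{p,q}(K)$. Coefficients in $G$ are obtained by tensoring with $G$. The filtration $F^p=\bigoplus_{i\le p}N^{i,*}(K;G)$ yields the cohomeology spectral sequence with $E_1^{p,q}=H^{q-p}(F^p/F^{p-1})$, $\Delta_r\colon E_r^{p,q}\to E_r^{p-r,q-r+1}$; $\mathcal{H}^{p,q}(K;G)=E_2^{p,q}$. The filtration $F_p=\bigoplus_{i\ge p}N_{i,*}(K;G)$ yields the homeology spectral sequence with $E^1_{p,q}=H_{q-p}(F_p/F_{p+1})$, $D_r\colon E^r_{p,q}\to E^r_{p+r,q+r-1}$; $\mathcal{H}_{p,q}(K;G)=E^2_{p,q}$. The reduced versions $\widetilde{\mathcal{H}}$ are obtained in the same way from $\widetilde N$. ''Induces''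 means: $f_*$ is induced by the bigraded maps $N_{*,*}(K;G)\to N_{*,*}(L;G)$ and $\widetilde N_{*,*}(K;G)\to\widetilde N_{*,*}(L;G)$ given by $f_*(\sigma\otimes\tau)=f(\sigma)\otimes f(\tau)$, and $f^*$ is induced by the dual maps $f^*(\sigma'\otimes\tau')=\sum\sigma\otimes\tau$, the sum over the generators $\sigma\otimes\tau$ for $K$ ($\sigma\subset\tau$, each taken with the orientation mapped by $f$ to that of $\sigma'$, $\tau'$) with $f(\sigma)=\sigma'$ and $f(\tau)=\tau'$. *)

(* Defs.v *)
From HB Require Import structures.
From mathcomp Require Import all_boot all_order all_algebra.
From mathcomp Require Import boolp functions.
From mathcomp Require Import zify.
Set Implicit Arguments.
Unset Strict Implicit.
Unset Printing Implicit Defensive.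
Import Order.TTheory GRing.Theory Num.Theory.
Local Open Scope ring_scope.

(* The spectral sequence of a filtered cochain complex, with the usual        *)
(*   Z_r^p = { x in F^p : d x in F^(p-r) },                                   *)
(*   E_r^p = Z_r^p / (Z_(r-1)^(p-1) + d Z_(r-1)^(p+r-1)),                     *)
(* F being increasing and d of degree +1; in particular E_1^p is the          *)
(* cohomology of F^p / F^(p-1), and d_r lowers p by r.                        *)

Record filtered_complex := FilteredComplex {
  carrier :> zmodType;
  diff : {additive carrier -> carrier};
  degree : int -> zmodClosed carrier;
  filt : int -> zmodClosed carrier;
  diff_diff : forall x, diff (diff x) = 0;
  diff_degree : forall n x, x \in degree n -> diff x \in degree (n + 1);
  diff_filt : forall p x, x \in filt p -> diff x \in filt p;
  filt_le : forall p q x, p <= q -> x \in filt p -> x \in filt q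
}.

Section Page.
Variables (C : filtered_complex) (r p n : int).

Definition cycles (r p n : int) : {pred C} :=
  fun x => [&& x \in degree C n, x \in filt C p & diff C x \in filt C (p - r)].

Fact cycles_zmod_closed r' p' n' : zmod_closed (cycles r' p' n').
Proof.
split=> [|x y]; first by rewrite /cycles unfold_in /= raddf0 !rpred0.
move=> /and3P[x1 x2 x3] /and3P[y1 y2 y3]; apply/and3P; split.
- exact: rpredB.
- exact: rpredB.
- by rewrite raddfB; exact: rpredB.
Qed.
HB.instance Definition _ r' p' n' :=
  GRing.isZmodClosed.Build C (cycles r' p' n') (cycles_zmod_closed r' p' n').

Record cycle := Cycle { cycle_val : C; _ : cycle_val \in cycles r p n }.
HB.instance Definition _ := [isSub for cycle_val].
HB.instance Definition _ := [Choice of cycle by <:].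
HB.instance Definition _ := [SubChoice_isSubZmodule of cycle by <:].

Definition boundary : {pred cycle} := fun x =>
  `[< exists y z, [/\ y \in cycles (r - 1) (p - 1) n,
                      z \in cycles (r - 1) (p + r - 1) (n - 1)
                    & val x = y + diff C z] >].

Fact boundary_zmod_closed : zmod_closed boundary.
Proof.
split=> [|x x'].
  by apply/asboolP; exists 0, 0; rewrite raddf0 addr0 raddf0 !rpred0.
move=> /asboolP[y [z [hy hz e]]] /asboolP[y' [z' [hy' hz' e']]].
apply/asboolP; exists (y - y'), (z - z'); split; [exact: rpredB|exact: rpredB|].
by rewrite [LHS]raddfB /= e e' raddfB opprD addrACA.
Qed.
HB.instance Definition _ :=
  GRing.isZmodClosed.Build cycle boundary boundary_zmod_closed.

Definition page : zmodType := Quotient.quot boundary.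

Definition page_class (x : cycle) : page := (\pi_(Quotient.quot boundary) x)%qT.

End Page.

(* phi([x]) = [F x] for all x in Z_r, F x being in Z_r.                       *)
Definition induces (C C' : filtered_complex) (F : C -> C') (r p n : int)
    (phi : page C r p n -> page C' r p n) : Prop :=
  forall x : cycle C r p n, exists y : cycle C' r p n,
    val y = F (val x) /\ phi (page_class x) = page_class y.

Record simplicial_complex (S : finType) := SimplicialComplex {
  simplices : {set {set S}};
  vertex_simplex : forall v : S, [set v] \in simplices;
  face_simplex : forall A B : {set S},
    A \subset B -> B \in simplices -> A \in simplices;
  (* not a consequence of [face_simplex] when S is empty *)
  empty_simplex : set0 \in simplices
}.

Definition simplicial_map (S S' : finType) (K : simplicial_complex S)
    (L : simplicial_complex S') (f : S -> S') : Prop :=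
  forall A : {set S}, A \in simplices K -> f @: A \in simplices L.

Definition nondegenerate_map (S S' : finType) (K : simplicial_complex S)
    (f : S -> S') : Prop :=
  forall A : {set S}, A \in simplices K -> #|f @: A| = #|A|.

Section Seq.
Variables (S : finType) (G : zmodType).
Implicit Types (c : seq S -> G) (s t : seq S).

Definition del i s := take i s ++ drop i.+1 s.

(* The values of a function [c] of oriented simplices on the boundary of [s]  *)
(* and on its coboundary.                                                     *)
Definition bd c s : G := \sum_(i < size s) c (del i s) *~ (-1) ^+ i.
Definition cobd c s : G := \sum_(v : S) c (v :: s).

Definition alternating c : Prop := forall s1 a b s2,
  c (s1 ++ a :: b :: s2) = - c (s1 ++ b :: a :: s2).

(* The sign of the permutation taking [s] to [t], as the parity of the number *)
(* of inversions; meaningful when [uniq s] and [perm_eq s t].                 *)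
Fixpoint inversions (u : seq nat) : nat :=
  if u is a :: u' then (count (fun b => b < a) u' + inversions u')%N else 0%N.
Definition orientation s t : int := (-1) ^+ inversions (map (index^~ s) t).

Lemma del_cons a s i : del i.+1 (a :: s) = a :: del i s.
Proof. by []. Qed.

Lemma bd_nil c : bd c [::] = 0.
Proof. by rewrite /bd big_ord0. Qed.

Lemma bd_cons c a s : bd c (a :: s) = c s - bd (fun u => c (a :: u)) s.
Proof.
rewrite /bd /= big_ord_recl /del /= drop0 expr0 mulr1z; congr (_ + _).
rewrite -sumrN; apply: eq_bigr => i _ /=.
by rewrite exprS mulN1r mulrNz.
Qed.

Lemma eq_bd c c' s : c =1 c' -> bd c s = bd c' s.
Proof. by move=> h; apply: eq_bigr => i _; rewrite h. Qed.

Lemma eq_bd_del c c' s :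
  (forall i : 'I_(size s), c (del i s) = c' (del i s)) -> bd c s = bd c' s.
Proof. by move=> h; apply: eq_bigr => i _; rewrite h. Qed.

Lemma size_del s (i : 'I_(size s)) : size s = (size (del i s)).+1.
Proof.
rewrite size_cat size_take size_drop (ltn_ord i) -addnS subnSK //.
by rewrite subnKC // ltnW.
Qed.

Lemma sign_del s (i : 'I_(size s)) :
  (-1) ^+ size s = - (-1) ^+ size (del i s) :> int.
Proof. by rewrite {1}(size_del i) exprS mulN1r. Qed.

Lemma del_subseq i s : subseq (del i s) s.
Proof.
rewrite -{2}(cat_take_drop i s); apply: cat_subseq => //.
by rewrite -addn1 addnC -drop_drop; apply: drop_subseq.
Qed.

Lemma bd_cobd (x : seq S -> seq S -> G) s t :
  bd (fun u => cobd (x u) t) s = cobd (fun w => bd (x^~ w) s) t.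
Proof.
rewrite /bd /cobd exchange_big; apply: eq_bigr => i _ /=.
by rewrite mulrz_suml.
Qed.

Lemma bdB c c' s : bd (fun u => c u - c' u) s = bd c s - bd c' s.
Proof. by rewrite -sumrB; apply: eq_bigr => i _; rewrite mulrzBl. Qed.

Lemma bdD c c' s : bd (fun u => c u + c' u) s = bd c s + bd c' s.
Proof. by rewrite -big_split; apply: eq_bigr => i _; rewrite mulrzDl. Qed.

Lemma bdN c s : bd (fun u => - c u) s = - bd c s.
Proof. by rewrite -sumrN; apply: eq_bigr => i _; rewrite mulNrz. Qed.

Lemma bdMz c m s : bd (fun u => c u *~ m) s = bd c s *~ m.
Proof. by rewrite mulrz_suml; apply: eq_bigr => i _; rewrite -!mulrzA mulrC. Qed.

Lemma cobdD c c' s : cobd (fun u => c u + c' u) s = cobd c s + cobd c' s.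
Proof. by rewrite -big_split. Qed.

Lemma cobdB c c' s : cobd (fun u => c u - c' u) s = cobd c s - cobd c' s.
Proof. by rewrite -sumrB. Qed.

Lemma cobdMz c m s : cobd (fun u => c u *~ m) s = cobd c s *~ m.
Proof. by rewrite [RHS]mulrz_suml. Qed.

Lemma eq_cobd c c' s : c =1 c' -> cobd c s = cobd c' s.
Proof. by move=> h; apply: eq_bigr => i _; rewrite h. Qed.

Lemma alternating_cons c a : alternating c -> alternating (fun u => c (a :: u)).
Proof. by move=> h s1 b b' s2; apply: (h (a :: s1)). Qed.

Lemma alternating_bd c : alternating c -> alternating (bd c).
Proof.
move=> + s1; elim: s1 c => [|x s1 IH] c hc a b s2; last first.
  by rewrite !cat_cons !bd_cons hc IH ?opprD //; apply: alternating_cons.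
rewrite !cat0s !bd_cons.
rewrite (@eq_bd (fun u => c (a :: b :: u)) (fun u => - c (b :: a :: u))).
  by rewrite bdN opprK opprB opprD addrA addrAC.
by move=> u; apply: (hc [::]).
Qed.

Lemma alternating_cobd c : alternating c -> alternating (cobd c).
Proof.
move=> hc s1 a b s2; rewrite /cobd -sumrN; apply: eq_bigr => v _.
exact: (hc (v :: s1)).
Qed.

Lemma bd_bd c s : bd (bd c) s = 0.
Proof.
elim: s c => [|a s IH] c; first exact: bd_nil.
rewrite bd_cons.
under [X in _ - X]eq_bd do rewrite bd_cons.
by rewrite bdB IH subr0 subrr.
Qed.

Lemma cobd_cobd c s : alternating c ->
  (forall v, c (v :: v :: s) = 0) -> cobd (cobd c) s = 0.
Proof.
move=> hc h0; rewrite /cobd.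
pose T := \sum_(v : S) \sum_(w : S | (enum_rank w < enum_rank v)%N) c (w :: v :: s).
have -> : \sum_(v : S) \sum_(w : S) c (w :: v :: s) =
    T + \sum_(v : S) \sum_(w : S | (enum_rank v < enum_rank w)%N) c (w :: v :: s).
  rewrite -big_split; apply: eq_bigr => v _ /=.
  rewrite (bigID (fun w => (enum_rank w < enum_rank v)%N)) /=; congr (_ + _).
  rewrite (bigD1 v) ?ltnn //= h0 add0r; apply: eq_bigl => w.
  by rewrite -leqNgt ltn_neqAle (inj_eq val_inj) (inj_eq enum_rank_inj) andbC eq_sym.
rewrite [X in _ + X](exchange_big_dep predT) //= /T -big_split /=.
apply: big1 => v _; rewrite -big_split /=; apply: big1 => w _.
by rewrite (hc [::]) addNr.
Qed.

End Seq.

Section Orientation.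
Variable S : finType.
Implicit Types (s t : seq S).

Lemma inversions_swap u1 (a b : nat) u2 : a != b ->
  (-1) ^+ inversions (u1 ++ a :: b :: u2)
    = - (-1) ^+ inversions (u1 ++ b :: a :: u2) :> int.
Proof.
move=> ab; elim: u1 => [|x u1 IH] /=.
  rewrite !exprD; have : (a < b)%N \/ (b < a)%N by lia.
  by case=> h; rewrite h ltnNge ltnW //= ?expr0 ?expr1; lia.
rewrite !exprD IH mulrN; congr (- (_ ^+ _ * _)).
by rewrite !count_cat /=; lia.
Qed.

Lemma inversions_bump k u : inversions (map (bump k) u) = inversions u.
Proof.
elim: u => //= a u ->; congr (_ + _)%N; rewrite count_map; apply: eq_count => b /=.
by rewrite /bump; lia.
Qed.

Lemma orientation_cons s1 a s2 s' : uniq (s1 ++ a :: s2) -> perm_eq (s1 ++ s2) s' ->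
  orientation (s1 ++ a :: s2) (a :: s')
    = (-1) ^+ size s1 * orientation (s1 ++ s2) s'.
Proof.
rewrite -[a :: s2]cat1s uniq_catCA cat1s => /= /andP[na us] hp.
rewrite /orientation /=.
have na1 : a \notin s1 by apply: contra na; rewrite mem_cat => ->.
have ia : index a (s1 ++ a :: s2) = size s1.
  by rewrite index_cat (negPf na1) /= eqxx addn0.
have -> : map (index^~ (s1 ++ a :: s2)) s'
    = map (bump (size s1)) (map (index^~ (s1 ++ s2)) s').
  rewrite -map_comp; apply/eq_in_map => v; rewrite -(perm_mem hp) => hv /=.
  have va : v != a by apply: contra na => /eqP<-.
  rewrite !index_cat /bump /=; case: ifPn => v1.
    by rewrite leqNgt index_mem v1.
  by rewrite eq_sym (negPf va); lia.
rewrite inversions_bump exprD; congr (_ ^+ _ * _); rewrite ia.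
rewrite -map_comp count_map -(permP hp) count_cat.
rewrite (eq_in_count (a2 := predT)) => [|v v1]; last first.
  have := v1; rewrite -index_mem /bump /= index_cat v1; lia.
rewrite count_predT (eq_in_count (a2 := pred0)) ?count_pred0 ?addn0 // => v v2 /=.
have v1 : v \notin s1.
  by move: us; rewrite cat_uniq => /and3P[_ /hasPn h _]; apply: h.
rewrite /bump index_cat (negPf v1) leq_addr add1n; apply/negbTE.
by rewrite -leqNgt leqW ?leq_addr // leqW ?leq_addr.
Qed.

Lemma orientation_refl s : uniq s -> orientation s s = 1.
Proof.
elim: s => [//|a s IH] us; rewrite -[LHS]/(orientation ([::] ++ a :: s) (a :: s)).
by rewrite orientation_cons //= mul1r IH //; case/andP: us.
Qed.

Lemma orientation_swap s t1 a b t2 : perm_eq s (t1 ++ a :: b :: t2) -> uniq s ->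
  orientation s (t1 ++ a :: b :: t2) = - orientation s (t1 ++ b :: a :: t2).
Proof.
move=> hp us; rewrite /orientation !map_cat /= inversions_swap //.
have := us; rewrite (perm_uniq hp) cat_uniq /= => /and4P[_ _ + _].
rewrite inE negb_or => /andP[ab _]; apply: contra ab => /eqP e.
have ma : a \in s by rewrite (perm_mem hp) mem_cat !inE eqxx orbT.
have mb : b \in s by rewrite (perm_mem hp) mem_cat !inE eqxx !orbT.
by rewrite -(nth_index a ma) e (nth_index a mb).
Qed.

Lemma orientation_sq s t : orientation s t * orientation s t = 1.
Proof. by rewrite /orientation -expr2 sqrr_sign. Qed.

Section Alternating.
Variables (G : zmodType).
Implicit Type c : seq S -> G.

Lemma alternating_move c s1 a s2 : alternating c ->
  c (s1 ++ a :: s2) = c (a :: s1 ++ s2) *~ (-1) ^+ size s1.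
Proof.
elim: s1 c => [|b s1 IH] c hc; first by rewrite mulr1z.
rewrite cat_cons (IH (fun u => c (b :: u))); last exact: alternating_cons.
by rewrite (hc [::]) exprS mulN1r mulNrz mulrNz.
Qed.

Lemma alternating_orientation c s s' : alternating c -> uniq s -> perm_eq s s' ->
  c s' = c s *~ orientation s s'.
Proof.
elim: s' c s => [|a s' IH] c s hc us hp.
  by move: hp => /perm_nilP ->; rewrite mulr1z.
have ma : a \in s by rewrite (perm_mem hp) inE eqxx.
case/splitPr: ma us hp => s1 s2 us.
rewrite -cat1s perm_catCA perm_cons => hp.
rewrite orientation_cons // (alternating_move _ _ _ hc) -mulrzA mulrA -expr2 sqrr_sign mul1r.
apply: (IH (fun u => c (a :: u))) => //; first exact: alternating_cons.
by move: us; rewrite -cat1s uniq_catCA => /andP[].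
Qed.

End Alternating.

(* The coefficient at [t] of the oriented simplex [s].                        *)
Definition osign s t : int := if perm_eq s t then orientation s t else 0.

Lemma osign_alternating s : uniq s -> alternating (osign s).
Proof.
move=> us t1 a b t2; rewrite /osign.
have -> : perm_eq s (t1 ++ b :: a :: t2) = perm_eq s (t1 ++ a :: b :: t2).
  apply: permPr; rewrite perm_cat2l.
  by rewrite -[b :: a :: _]/([:: b] ++ [:: a] ++ t2) perm_catCA.
by case: ifP => h; rewrite ?oppr0 // orientation_swap.
Qed.

Lemma osignC s t : uniq s -> osign s t = osign t s.
Proof.
move=> us; rewrite /osign perm_sym; case: ifP => // h.
have hp : perm_eq s t by rewrite perm_sym.
have ut : uniq t by rewrite (perm_uniq h).
have := alternating_orientation (osign_alternating us) ut h.
rewrite /osign perm_refl hp orientation_refl // mulrzz => e.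
by rewrite -[orientation t s]mul1r -(orientation_sq s t) -mulrA -e mulr1.
Qed.

Lemma cobd_osign s t : uniq s -> cobd (osign s) t = bd (fun u => osign u t) s.
Proof.
move=> us; rewrite /cobd (bigID (mem s)) /= [X in _ + X]big1 ?addr0; last first.
  move=> v vs; rewrite /osign; case: ifP => // h.
  by move: vs; rewrite (perm_mem h) inE eqxx.
rewrite -big_uniq // /bd (big_tnth _ _ s); apply: eq_bigr => i _.
set v := tnth _ _.
have e : s = take i s ++ v :: drop i.+1 s.
  by rewrite /v (tnth_nth v) /= -drop_nth // cat_take_drop.
have key s1 s2 : s = s1 ++ v :: s2 ->
    osign s (v :: t) = osign (s1 ++ s2) t *~ (-1) ^+ size s1.
  move=> es; rewrite /osign es -cat1s perm_catCA perm_cons.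
  case: ifP => h; last by rewrite mul0rz.
  by rewrite cat1s orientation_cons -?es // mulrzz mulrC.
by rewrite (key _ _ e) size_takel // ltnW.
Qed.

Lemma bd_osign s t : uniq s -> uniq t ->
  bd (osign s) t = cobd (fun u => osign u t) s.
Proof.
move=> us ut; rewrite (eq_bd _ (fun u => osignC u us)) -cobd_osign //.
by apply: eq_bigr => v _; rewrite osignC.
Qed.

End Orientation.

Section N.
Variables (reduced : bool) (S : finType) (K : simplicial_complex S) (G : zmodType).
Implicit Types (s t : seq S) (g : G).

Definition oriented_simplex s := uniq s && ([set v in s] \in simplices K).

Definition generator s t := [&& oriented_simplex s, oriented_simplex t,
  [set v in s] \subset [set v in t] & reduced || (s != [::])].

(* The direct sum of all N^{p,q}(K;G): an oriented chain is given by its      *)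
(* coefficients, an alternating function of the ordered simplices, and the    *)
(* coefficient of s (x) t in x is [x s t]. The summand of bidegree (p,q)      *)
(* consists of the functions supported on pairs with |s| = p + 1, |t| = q + 1.*)
(* It also serves as the direct sum of all N_{p,q}(K;G), x being then read as *)
(* the homomorphism with value [x s t] at the generator s (x) t; the dual     *)
(* basis element of s (x) t is then s (x) t itself.                           *)
(* [reduced = false] excludes the empty simplex, i.e. p = -1.                 *)
Definition is_chain : {pred seq S -> seq S -> G} := fun x =>
  `[< [/\ forall s t, ~~ generator s t -> x s t = 0,
          forall t, alternating (x^~ t) & forall s, alternating (x s)] >].

Fact is_chain_zmod_closed : zmod_closed is_chain.
Proof.
split=> [|x y]; first by apply/asboolP; split=> // [t|s] s1 a b s2;
    by change (0 = - 0 :> G); rewrite oppr0.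
move=> /asboolP[x1 x2 x3] /asboolP[y1 y2 y3]; apply/asboolP; split.
- by move=> s t h; rewrite !fctE x1 // y1 // subr0.
- by move=> t s1 a b s2; rewrite !fctE x2 y2 -opprD.
- by move=> s s1 a b s2; rewrite !fctE x3 y3 -opprD.
Qed.
HB.instance Definition _ := GRing.isZmodClosed.Build _ is_chain is_chain_zmod_closed.

Record N := Chain { coef :> seq S -> seq S -> G; _ : coef \in is_chain }.
HB.instance Definition _ := [isSub for coef].
HB.instance Definition _ := [Choice of N by <:].
HB.instance Definition _ := [SubChoice_isSubZmodule of N by <:].


Lemma coefP (x : N) : [/\ forall s t, ~~ generator s t -> x s t = 0,
  forall t, alternating (x^~ t) & forall s, alternating (x s)].
Proof. by case: x => x hx; apply/asboolP. Qed.

Lemma coef0 (x : N) s t : ~~ generator s t -> x s t = 0.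
Proof. by case: (coefP x) => + _ _; apply. Qed.

Lemma coef_altl (x : N) t : alternating (x^~ t).
Proof. by case: (coefP x) => _ + _; apply. Qed.

Lemma coef_altr (x : N) s : alternating (x s).
Proof. by case: (coefP x) => _ _; apply. Qed.

Lemma N_eq (x y : N) : (forall s t, generator s t -> x s t = y s t) -> x = y.
Proof.
move=> h; apply: val_inj; apply/funext => s; apply/funext => t /=.
by case: (boolP (generator s t)) => [/h //|hg]; rewrite !coef0.
Qed.

Lemma vset_perm s s' : perm_eq s s' -> [set v in s] = [set v in s'].
Proof. by move=> h; apply/setP => v; rewrite !inE (perm_mem h). Qed.

Lemma oriented_simplex_perm s s' : perm_eq s s' ->
  oriented_simplex s = oriented_simplex s'.
Proof. by move=> h; rewrite /oriented_simplex (perm_uniq h) (vset_perm h). Qed.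

Lemma generator_perm s s' t t' : perm_eq s s' -> perm_eq t t' ->
  generator s t = generator s' t'.
Proof.
move=> hs ht; rewrite /generator (oriented_simplex_perm hs).
rewrite (oriented_simplex_perm ht) (vset_perm hs) (vset_perm ht).
by rewrite -!size_eq0 (perm_size hs).
Qed.

Lemma perm_swap s1 (a b : S) s2 : perm_eq (s1 ++ a :: b :: s2) (s1 ++ b :: a :: s2).
Proof. by rewrite perm_cat2l -[a :: _]/([:: a] ++ [:: b] ++ s2) perm_catCA. Qed.

(* [Delta_fun x s t] is the coefficient of s (x) t in Delta x, d and delta    *)
(* being transposed to each other; [Delta_gen] below is the formula on        *)
(* generators. [D_fun x s t] is the value of x on Delta (s (x) t), so that    *)
(* D is the dual of Delta; see [ev_D].                                        *)
Definition D_fun (x : N) s t : G :=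
  if generator s t then bd (x^~ t) s + cobd (x s) t *~ (-1) ^+ size s else 0.

Definition Delta_fun (x : N) s t : G :=
  if generator s t then cobd (x^~ t) s + bd (x s) t *~ (-1) ^+ size s else 0.

Fact D_fun_is_chain x : D_fun x \in is_chain.
Proof.
apply/asboolP; split=> [s t /negPf h|t|s]; first by rewrite /D_fun h.
- move=> s1 a b s2; rewrite /D_fun (generator_perm (perm_swap s1 a b s2) (perm_refl t)).
  case: ifP => _; rewrite ?oppr0 // (alternating_bd (@coef_altl x t)).
  rewrite (perm_size (perm_swap s1 a b s2)) opprD -mulNrz /cobd -sumrN.
  by congr (_ + _ *~ _); apply: eq_bigr => v _; rewrite coef_altl.
- move=> t1 a b t2; rewrite /D_fun (generator_perm (perm_refl s) (perm_swap t1 a b t2)).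
  case: ifP => _; rewrite ?oppr0 // (alternating_cobd (@coef_altr x s)).
  rewrite opprD mulNrz -bdN; congr (_ + _).
  by apply: eq_bd => u; rewrite coef_altr.
Qed.

Fact Delta_fun_is_chain x : Delta_fun x \in is_chain.
Proof.
apply/asboolP; split=> [s t /negPf h|t|s]; first by rewrite /Delta_fun h.
- move=> s1 a b s2.
  rewrite /Delta_fun (generator_perm (perm_swap s1 a b s2) (perm_refl t)).
  case: ifP => _; rewrite ?oppr0 // (alternating_cobd (@coef_altl x t)).
  rewrite (perm_size (perm_swap s1 a b s2)) opprD -mulNrz -bdN.
  by congr (_ + _ *~ _); apply: eq_bd => u; rewrite coef_altl.
- move=> t1 a b t2.
  rewrite /Delta_fun (generator_perm (perm_refl s) (perm_swap t1 a b t2)).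
  case: ifP => _; rewrite ?oppr0 // (alternating_bd (@coef_altr x s)).
  rewrite opprD mulNrz /cobd -sumrN; congr (_ + _).
  by apply: eq_bigr => u _; rewrite coef_altr.
Qed.

Definition D (x : N) : N := Chain (D_fun_is_chain x).
Definition Delta (x : N) : N := Chain (Delta_fun_is_chain x).

Fact D_is_zmod_morphism : zmod_morphism D.
Proof.
move=> x y; apply: N_eq => s t h.
rewrite [LHS]/(D_fun _ _ _) [RHS]/(D_fun _ _ _ - D_fun _ _ _) /D_fun h.
rewrite [bd _ s](bdB (x^~ t) (y^~ t)).
rewrite [cobd _ t](cobdB (x s) (y s)).
by rewrite mulrzBl opprD addrACA.
Qed.
HB.instance Definition _ := GRing.isZmodMorphism.Build N N D D_is_zmod_morphism.

Fact Delta_is_zmod_morphism : zmod_morphism Delta.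
Proof.
move=> x y; apply: N_eq => s t h.
rewrite [LHS]/(Delta_fun _ _ _) [RHS]/(Delta_fun _ _ _ - Delta_fun _ _ _).
rewrite /Delta_fun h.
rewrite [bd _ t](bdB (x s) (y s)).
rewrite [cobd _ s](cobdB (x^~ t) (y^~ t)).
by rewrite mulrzBl opprD addrACA.
Qed.
HB.instance Definition _ :=
  GRing.isZmodMorphism.Build N N Delta Delta_is_zmod_morphism.

Lemma oriented_simplex_sub s s' : uniq s -> [set v in s] \subset [set v in s'] ->
  oriented_simplex s' -> oriented_simplex s.
Proof.
by move=> us hs /andP[_ h]; rewrite /oriented_simplex us (face_simplex hs h).
Qed.

Lemma vset_subseq s s' : subseq s s' -> [set v in s] \subset [set v in s'].
Proof. by move=> h; apply/subsetP => v; rewrite !inE; apply: mem_subseq. Qed.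

Lemma oriented_simplex_subseq s s' : subseq s s' ->
  oriented_simplex s' -> oriented_simplex s.
Proof.
move=> h o; have /andP[u _] := o.
exact: oriented_simplex_sub (subseq_uniq h u) (vset_subseq h) o.
Qed.

Lemma generator_consl v s t : reduced || (s != [::]) ->
  generator (v :: s) t -> generator s t.
Proof.
move=> r /and4P[o1 o2 h _]; apply/and4P; split=> //.
  exact: oriented_simplex_subseq (subseq_cons _ _) o1.
exact: subset_trans (vset_subseq (subseq_cons _ _)) h.
Qed.

Lemma generator_delr i s t : oriented_simplex t ->
  generator s (del i t) -> generator s t.
Proof.
move=> o /and4P[o1 o2 h r]; apply/and4P; split=> //.
exact: subset_trans h (vset_subseq (del_subseq _ _)).
Qed.

Lemma generator_dell i s t : uniq s -> [set v in s] \subset [set v in t] ->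
  generator (del i s) t -> generator s t.
Proof.
move=> us st /and4P[o1 o2 h r]; apply/and4P; split=> //.
  exact: oriented_simplex_sub o2.
by move: r; case: (s) => [|a u] //; rewrite orbT.
Qed.

Lemma generator_consr v s t : [set v in s] \subset [set v in t] ->
  generator s (v :: t) -> generator s t.
Proof.
move=> st /and4P[o1 o2 h r]; apply/and4P; split=> //.
exact: oriented_simplex_subseq (subseq_cons _ _) o2.
Qed.

Lemma D_eq (x : N) s t : uniq s -> [set v in s] \subset [set v in t] ->
  D x s t = bd (x^~ t) s + cobd (x s) t *~ (-1) ^+ size s.
Proof.
move=> us st; rewrite [LHS]/(D_fun x s t) /D_fun; case: ifPn => // /negP ng.
rewrite /bd /cobd !big1 ?mul0rz ?addr0 // => [v|i] _.
  by apply: coef0; apply/negP => /(generator_consr st).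
by rewrite coef0 ?mul0rz //; apply/negP => /(generator_dell us st).
Qed.

Lemma Delta_eq (x : N) s t : oriented_simplex t -> reduced || (s != [::]) ->
  Delta x s t = cobd (x^~ t) s + bd (x s) t *~ (-1) ^+ size s.
Proof.
move=> ot r; rewrite [LHS]/(Delta_fun x s t) /Delta_fun; case: ifPn => // /negP ng.
rewrite /bd /cobd !big1 ?mul0rz ?addr0 // => [i|v] _.
  by rewrite coef0 ?mul0rz //; apply/negP => /(generator_delr ot).
by apply: coef0; apply/negP => /(generator_consl r).
Qed.

Lemma not_generatorl s t : ~~ uniq s -> ~~ generator s t.
Proof. by rewrite /generator /oriented_simplex => /negPf->. Qed.

Lemma not_generatorr s t : ~~ uniq t -> ~~ generator s t.
Proof. by rewrite /generator /oriented_simplex => /negPf->; rewrite andbF. Qed.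

Lemma D_D (x : N) : D (D x) = 0.
Proof.
apply: N_eq => s t /and4P[os ot st _]; have /andP[us _] := os.
rewrite D_eq //.
rewrite (@eq_bd_del _ _ _ (fun u => bd (x^~ t) u - cobd (x u) t *~ (-1) ^+ size s)).
  have -> : cobd (D x s) t =
      cobd (fun w => bd (x^~ w) s) t + cobd (fun w => cobd (x s) w) t *~ (-1) ^+ size s.
    rewrite -cobdMz -cobdD; apply: eq_bigr => v _; rewrite D_eq //.
    exact: subset_trans st (vset_subseq (subseq_cons _ _)).
  rewrite bdB bdMz bd_bd cobd_cobd ?mul0rz ?addr0; last first.
  - by move=> v; apply/coef0/not_generatorr; rewrite /= inE eqxx.
  - exact: coef_altr.
  by rewrite bd_cobd sub0r addNr.
move=> i; rewrite D_eq.
- by rewrite (sign_del i) mulrNz opprK.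
- exact: subseq_uniq (del_subseq _ _) us.
- exact: subset_trans (vset_subseq (del_subseq _ _)) st.
Qed.

Lemma Delta_Delta (x : N) : Delta (Delta x) = 0.
Proof.
apply: N_eq => s t /and4P[os ot st r].
rewrite Delta_eq //.
rewrite (@eq_bd_del _ _ _ (fun w => cobd (x^~ w) s + bd (x s) w *~ (-1) ^+ size s)).
  have -> : cobd ((Delta x)^~ t) s =
      cobd (fun u => cobd (x^~ t) u) s - cobd (fun u => bd (x u) t) s *~ (-1) ^+ size s.
    rewrite -cobdMz -cobdB; apply: eq_bigr => v _.
    by rewrite Delta_eq ?orbT //= exprS mulN1r mulrNz.
  rewrite bdD bdMz bd_bd mul0rz addr0 cobd_cobd; last first.
  - by move=> v; apply/coef0/not_generatorl; rewrite /= inE eqxx.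
  - exact: coef_altl.
  by rewrite sub0r -(bd_cobd (fun w u => x u w)) addNr.
move=> i; rewrite Delta_eq //.
exact: oriented_simplex_subseq (del_subseq _ _) ot.
Qed.

(* The generator s (x) t with coefficient g; zero unless [generator s t].     *)
Definition gen_fun s t g : seq S -> seq S -> G := fun s' t' =>
  if generator s t then g *~ (osign s s' * osign t t') else 0.

Lemma osign_neq0 s s' : osign s s' != 0 -> perm_eq s s'.
Proof. by rewrite /osign; case: ifP => //; rewrite eqxx. Qed.

Fact gen_fun_is_chain s t g : gen_fun s t g \in is_chain.
Proof.
apply/asboolP; rewrite /gen_fun; case: (boolP (generator s t)) => h; last first.
  by split=> // [t'|s'] s1 a b s2; rewrite oppr0.
have /and4P[/andP[us _] /andP[ut _] _ _] := h.
split=> [s' t' h'|t' s1 a b s2|s' s1 a b s2].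
- case: (eqVneq (osign s s' * osign t t') 0) => [->|]; first by rewrite mulr0z.
  rewrite mulf_eq0 negb_or => /andP[/osign_neq0 hs /osign_neq0 ht].
  by case/negP: h'; rewrite -(generator_perm hs ht).
- by rewrite (osign_alternating us) mulNr mulrNz.
- by rewrite (osign_alternating ut) mulrN mulrNz.
Qed.

Definition gen s t g : N := Chain (gen_fun_is_chain s t g).

Lemma genE s t g s' t' : generator s t ->
  gen s t g s' t' = g *~ (osign s s' * osign t t').
Proof. by rewrite /= /gen_fun => ->. Qed.

Lemma gen_out s t g : ~~ generator s t -> gen s t g = 0.
Proof. by move=> /negPf h; apply: N_eq => s' t' _; rewrite /= /gen_fun h. Qed.

Lemma gen_altl s1 a b s2 t g :
  gen (s1 ++ a :: b :: s2) t g = - gen (s1 ++ b :: a :: s2) t g.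
Proof.
have hp := perm_swap s1 a b s2.
case: (boolP (generator (s1 ++ a :: b :: s2) t)) => h; last first.
  by rewrite !gen_out ?oppr0 // -(generator_perm hp (perm_refl t)).
have h' := h; rewrite (generator_perm hp (perm_refl t)) in h'.
have /and4P[/andP[us _] _ _ _] := h; have /and4P[/andP[us' _] _ _ _] := h'.
apply: N_eq => s' t' /and4P[/andP[u _] _ _ _].
rewrite genE // [RHS]/(- gen (s1 ++ b :: a :: s2) t g s' t') genE //.
by rewrite (osignC _ us) (osign_alternating u) -(osignC _ us') mulNr mulrNz.
Qed.

Lemma gen_altr s t1 a b t2 g :
  gen s (t1 ++ a :: b :: t2) g = - gen s (t1 ++ b :: a :: t2) g.
Proof.
have hp := perm_swap t1 a b t2.
case: (boolP (generator s (t1 ++ a :: b :: t2))) => h; last first.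
  by rewrite !gen_out ?oppr0 // -(generator_perm (perm_refl s) hp).
have h' := h; rewrite (generator_perm (perm_refl s) hp) in h'.
have /and4P[_ /andP[us _] _ _] := h; have /and4P[_ /andP[us' _] _ _] := h'.
apply: N_eq => s' t' /and4P[_ /andP[u _] _ _].
rewrite genE // [RHS]/(- gen s (t1 ++ b :: a :: t2) g s' t') genE //.
by rewrite (osignC _ us) (osign_alternating u) -(osignC _ us') mulrN mulrNz.
Qed.

Lemma coef_sum (I : Type) (r : seq I) (P : pred I) (F : I -> N) s t :
  (\sum_(i <- r | P i) F i) s t = \sum_(i <- r | P i) F i s t.
Proof. by apply: (big_morph (fun x : N => x s t)). Qed.

Lemma coefMz (x : N) (m : int) s t : (x *~ m) s t = x s t *~ m.
Proof.
have hn (n : nat) : (x *+ n) s t = x s t *+ n.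
  elim: n => [|n IH]; first by rewrite !mulr0n.
  by rewrite !mulrS -IH.
case: m => n; first exact: hn.
by rewrite !NegzE !mulrNz; exact: (congr1 -%R (hn n.+1)).
Qed.

(* Delta (s (x) t) = ds (x) t + (-1)^|s| s (x) delta t.                       *)
Lemma Delta_gen s t g : generator s t ->
  Delta (gen s t g) =
    \sum_(i < size s) gen (del i s) t g *~ (-1) ^+ i
    + (\sum_(v : S) gen s (v :: t) g) *~ (-1) ^+ size s.
Proof.
move=> h; have /and4P[os ot st r] := h.
have /andP[us _] := os; have /andP[ut _] := ot.
apply: N_eq => s' t' h'; have /and4P[os' ot' st' r'] := h'.
have /andP[us' _] := os'; have /andP[ut' _] := ot'.
rewrite Delta_eq //.
rewrite [RHS]/((\sum_(i < size s) gen (del i s) t g *~ (-1) ^+ i) s' t' +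
  ((\sum_(v : S) gen s (v :: t) g) *~ (-1) ^+ size s) s' t')%R.
rewrite coefMz !coef_sum; congr (_ + _).
  rewrite (eq_cobd _ (c' := fun u => g *~ (osign s u * osign t t'))); last first.
    by move=> u; rewrite genE.
  rewrite /cobd -mulrz_sumr -mulr_suml -/(cobd _ _) cobd_osign // /bd mulr_suml mulrz_sumr.
  apply: eq_bigr => i _.
  rewrite coefMz mulrzz mulrAC mulrzA.
  case: (boolP (generator (del i s) t)) => hd; first by rewrite genE.
  rewrite gen_out // [(0 : N) _ _]/(0 : G).
  case: (eqVneq (osign (del i s) s' * osign t t') 0) => [->|]; first by rewrite mulr0z.
  rewrite mulf_eq0 negb_or => /andP[/osign_neq0 hs /osign_neq0 ht].
  by rewrite (generator_perm hs ht) h' in hd.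
rewrite (eq_bd _ (c' := fun u => g *~ (osign s s' * osign t u))); last first.
  by move=> u; rewrite genE.
have -> : bd (fun u => g *~ (osign s s' * osign t u)) t' =
    g *~ (osign s s' * bd (osign t) t').
  rewrite /bd mulr_sumr mulrz_sumr; apply: eq_bigr => i _.
  by rewrite -mulrzA mulrzz mulrA.
have -> : \sum_(v : S) gen s (v :: t) g s' t' =
    g *~ (osign s s' * cobd (fun u => osign u t') t).
  rewrite /cobd mulr_sumr mulrz_sumr; apply: eq_bigr => v _.
  case: (boolP (generator s (v :: t))) => hd; first by rewrite genE.
  rewrite gen_out // [(0 : N) _ _]/(0 : G).
  case: (eqVneq (osign s s' * osign (v :: t) t') 0) => [->|]; first by rewrite mulr0z.
  rewrite mulf_eq0 negb_or => /andP[/osign_neq0 hs /osign_neq0 ht].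
  by rewrite (generator_perm hs ht) h' in hd.
rewrite bd_osign //.
case: (eqVneq (osign s s') 0) => [->|/osign_neq0 hs]; first by rewrite mul0r mulr0z !mul0rz.
by rewrite (perm_size hs).
Qed.

Lemma set_enum_seq (A : {set S}) : [set v in enum A] = A.
Proof. by apply/setP => v; rewrite inE mem_enum. Qed.

Lemma gen_span (x : N) :
  x = \sum_(A : {set S}) \sum_(B : {set S}) gen (enum A) (enum B) (x (enum A) (enum B)).
Proof.
apply: N_eq => s t h; have /and4P[/andP[us _] /andP[ut _] _ _] := h.
have hs : perm_eq (enum [set v in s]) s.
  by rewrite uniq_perm ?enum_uniq // => v; rewrite mem_enum inE.
have ht : perm_eq (enum [set v in t]) t.
  by rewrite uniq_perm ?enum_uniq // => v; rewrite mem_enum inE.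
rewrite coef_sum (bigD1 [set v in s]) //= coef_sum (bigD1 [set v in t]) //=.
rewrite big1 => [|B nB]; last first.
  rewrite /gen_fun; case: ifP => // _; rewrite /osign.
  case: (boolP (perm_eq (enum B) t)) => [/vset_perm|]; last by rewrite mulr0 mulr0z.
  by rewrite set_enum_seq => e; rewrite e eqxx in nB.
rewrite big1 => [|A nA]; last first.
  rewrite coef_sum big1 // => B _.
  rewrite /= /gen_fun; case: ifP => // _; rewrite /osign.
  case: (boolP (perm_eq (enum A) s)) => [/vset_perm|]; last by rewrite mul0r mulr0z.
  by rewrite set_enum_seq => e; rewrite e eqxx in nA.
rewrite !addr0 /gen_fun (generator_perm hs ht) h /osign hs ht.
rewrite (alternating_orientation (@coef_altl x t) (enum_uniq _) hs).
rewrite (alternating_orientation (@coef_altr x _) (enum_uniq _) ht).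
by rewrite -mulrzA mulrC.
Qed.

Definition supported (P : nat -> nat -> bool) : {pred N} := fun x =>
  `[< forall s t, x s t != 0 -> P (size s) (size t) >].

Fact supported_zmod_closed P : zmod_closed (supported P).
Proof.
split=> [|x y /asboolP hx /asboolP hy]; apply/asboolP => s t.
  by rewrite [(0 : N) s t]/(0 : G) eqxx.
have -> : (x - y) s t = x s t - y s t by [].
case: (eqVneq (x s t) 0) => [->|/hx//].
by rewrite sub0r oppr_eq0; apply: hy.
Qed.
HB.instance Definition _ P :=
  GRing.isZmodClosed.Build N (supported P) (supported_zmod_closed P).

Lemma bd_neq0 (c : seq S -> G) s : bd c s != 0 ->
  exists i : 'I_(size s), c (del i s) != 0.
Proof.
move=> h; apply/existsP; apply: contraR h => /existsPn h.
by rewrite /bd big1 // => i _; move: (h i); rewrite negbK => /eqP->; rewrite mul0rz.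
Qed.

Lemma cobd_neq0 (c : seq S -> G) s : cobd c s != 0 -> exists v, c (v :: s) != 0.
Proof.
move=> h; apply/existsP; apply: contraR h => /existsPn h.
by rewrite /cobd big1 // => i _; apply/eqP; move: (h i); rewrite negbK.
Qed.

Lemma D_supported (P Q : nat -> nat -> bool) x :
  (forall a b, P a b -> Q a.+1 b) -> (forall a b, P a b.+1 -> Q a b) ->
  x \in supported P -> D x \in supported Q.
Proof.
move=> h1 h2 /asboolP hx; apply/asboolP => s t.
rewrite [D x s t]/(D_fun x s t) /D_fun; case: ifP => _; last by rewrite eqxx.
case: (eqVneq (bd (x^~ t) s) 0) => [->|/bd_neq0[i /hx]]; last first.
  by move=> /h1; rewrite -size_del.
rewrite add0r; case: (eqVneq (cobd (x s) t) 0) => [->|/cobd_neq0[v /hx /h2]] //.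
by rewrite mul0rz eqxx.
Qed.

Lemma Delta_supported (P Q : nat -> nat -> bool) x :
  (forall a b, P a.+1 b -> Q a b) -> (forall a b, P a b -> Q a b.+1) ->
  x \in supported P -> Delta x \in supported Q.
Proof.
move=> h1 h2 /asboolP hx; apply/asboolP => s t.
rewrite [Delta x s t]/(Delta_fun x s t) /Delta_fun; case: ifP => _; last by rewrite eqxx.
case: (eqVneq (cobd (x^~ t) s) 0) => [->|/cobd_neq0[v /hx /h1]] //.
rewrite add0r; case: (eqVneq (bd (x s) t) 0) => [->|/bd_neq0[i /hx]].
  by rewrite mul0rz eqxx.
by move=> /h2; rewrite -size_del.
Qed.

Lemma supported_sub (P Q : nat -> nat -> bool) x : (forall a b, P a b -> Q a b) ->
  x \in supported P -> x \in supported Q.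
Proof. by move=> h /asboolP hx; apply/asboolP => s t /hx /h. Qed.

(* |s| - 1 and |t| - 1 are the first and second degree of s (x) t.            *)
Definition cochain_degree (n : int) := supported (fun a b => b%:Z - a%:Z == n).
Definition cochain_filt (p : int) := supported (fun a b => a%:Z - 1 <= p).

(* The decreasing filtration F_p and the differential D of degree -1 are      *)
(* made to fit [filtered_complex] by negating p and n.                        *)
Definition chain_degree (n : int) := supported (fun a b => b%:Z - a%:Z == - n).
Definition chain_filt (p : int) := supported (fun a b => - p <= a%:Z - 1).

Fact Delta_degree n x : x \in cochain_degree n -> Delta x \in cochain_degree (n + 1).
Proof. by apply: Delta_supported => a b; lia. Qed.

Fact Delta_filt p x : x \in cochain_filt p -> Delta x \in cochain_filt p.
Proof. by apply: Delta_supported => a b; lia. Qed.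

Fact cochain_filt_le p q x : p <= q -> x \in cochain_filt p -> x \in cochain_filt q.
Proof. by move=> pq; apply: supported_sub => a b; lia. Qed.

Fact D_degree n x : x \in chain_degree n -> D x \in chain_degree (n + 1).
Proof. by apply: D_supported => a b; lia. Qed.

Fact D_filt p x : x \in chain_filt p -> D x \in chain_filt p.
Proof. by apply: D_supported => a b; lia. Qed.

Fact chain_filt_le p q x : p <= q -> x \in chain_filt p -> x \in chain_filt q.
Proof. by move=> pq; apply: supported_sub => a b; lia. Qed.

Definition cochain_complex : filtered_complex :=
  @FilteredComplex N Delta cochain_degree cochain_filt
    Delta_Delta Delta_degree Delta_filt cochain_filt_le.

Definition chain_complex : filtered_complex :=
  @FilteredComplex N D chain_degree chain_filt
    D_D D_degree D_filt chain_filt_le.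

Definition cohomeology (p q : int) : zmodType := page cochain_complex 2 p (q - p).
Definition homeology (p q : int) : zmodType := page chain_complex 2 (- p) (- (q - p)).


End N.

Section Duality.
Variables (reduced : bool) (S : finType) (K : simplicial_complex S) (G : zmodType).
Implicit Types (x : N reduced K G) (y : N reduced K int) (s t : seq S).

(* The homomorphism N(K;Z) -> G given by x.                                   *)
Definition ev x y : G :=
  \sum_(A : {set S}) \sum_(B : {set S})
    x (enum A) (enum B) *~ y (enum A) (enum B).

Fact ev_is_zmod_morphism x : zmod_morphism (ev x).
Proof.
move=> y z; rewrite /ev -sumrB; apply: eq_bigr => A _.
by rewrite -sumrB; apply: eq_bigr => B _; rewrite -mulrzBr.
Qed.
HB.instance Definition _ x :=
  GRing.isZmodMorphism.Build (N reduced K int) G (ev x) (ev_is_zmod_morphism x).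

Lemma ev_gen x s t (m : int) : ev x (gen reduced K s t m) = x s t *~ m.
Proof.
case: (boolP (generator reduced K s t)) => h; last first.
  by rewrite gen_out // raddf0 coef0 // mul0rz.
have /and4P[/andP[us _] /andP[ut _] _ _] := h.
have hs : perm_eq s (enum [set v in s]).
  by rewrite uniq_perm ?enum_uniq // => v; rewrite mem_enum inE.
have ht : perm_eq t (enum [set v in t]).
  by rewrite uniq_perm ?enum_uniq // => v; rewrite mem_enum inE.
rewrite /ev (bigD1 [set v in s]) //= (bigD1 [set v in t]) //=.
rewrite big1 => [|B nB]; last first.
  rewrite /gen_fun h /osign.
  case: (boolP (perm_eq t (enum B))) => [/vset_perm|]; last by rewrite mulr0 !mulr0z.
  by rewrite set_enum_seq => e; rewrite e eqxx in nB.
rewrite big1 => [|A nA]; last first.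
  rewrite big1 // => B _; rewrite /gen_fun h /osign.
  case: (boolP (perm_eq s (enum A))) => [/vset_perm|]; last by rewrite mul0r !mulr0z.
  by rewrite set_enum_seq => e; rewrite e eqxx in nA.
rewrite !addr0 /gen_fun h /osign hs ht.
rewrite (alternating_orientation (@coef_altl _ _ _ _ x (enum [set v in t])) us hs).
rewrite (alternating_orientation (@coef_altr _ _ _ _ x s) ut ht).
rewrite -!mulrzA mulrzz.
congr (_ *~ _); rewrite (mulrCA _ m) (mulrCA _ m).
by rewrite [X in m * (_ * X)]mulrA orientation_sq mul1r orientation_sq mulr1.
Qed.

Lemma ev_D x y : ev (D x) y = ev x (Delta y).
Proof.
rewrite {1}(gen_span y) [in RHS](gen_span y) !raddf_sum; apply: eq_bigr => A _.
rewrite !raddf_sum; apply: eq_bigr => B _ /=.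
set s := enum A; set t := enum B; set m := y s t.
case: (boolP (generator reduced K s t)) => h; last by rewrite gen_out // !raddf0.
rewrite Delta_gen // raddfD raddf_sum raddfMz raddf_sum ev_gen.
rewrite [D x s t]/(D_fun x s t) /D_fun h mulrzDl; congr (_ + _).
  rewrite /bd mulrz_suml; apply: eq_bigr => i _.
  by rewrite raddfMz /= ev_gen -!mulrzA mulrC.
rewrite /cobd -mulrzA mulrC mulrzA mulrz_suml; congr (_ *~ _).
by apply: eq_bigr => v _; rewrite /= ev_gen.
Qed.

End Duality.

(* Main.v *)
Require Import Defs.
From HB Require Import structures.
From mathcomp Require Import all_boot all_order all_algebra.
From mathcomp Require Import boolp.
Set Implicit Arguments.
Unset Strict Implicit.
Unset Printing Implicit Defensive.
Import Order.TTheory GRing.Theory Num.Theory.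
Local Open Scope ring_scope.

(** A non-degenerate simplicial map is injective on the vertices of each simplex,
    and both differentials only see vertices of a single simplex: the generators
    that occur in [D (s (x) t)], and likewise those whose coefficients enter the
    coefficient of a [Delta x] at [s (x) t], arise by adding to [s] a vertex of [t]
    or by deleting from [t] a vertex outside [s]. On these vertices [f] is a
    bijection onto those of [f(t)], so the terms for [K] and for [L] match.

    Cochains are alternating coefficient functions, so [f^*] is composition with
    [f], cut off to the generators of [K]. Injectivity on [t] gives
    [f^* Delta = Delta f^*] ([Delta_pullback]): a term that the cut-off kills on
    the [K] side also vanishes on the [L] side, because there the first simplex is
    no longer inside the second or has a repeated vertex. A chain with coefficients
    in [G] is a homomorphism from the integral cochains to [G], so [f_*] can be
    taken as the transpose of [f^*], and [f_* D = D f_*] follows from [D] being the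
    transpose of [Delta] ([pushforward_D]).

    The values on generators come from the same injectivity: an ordering of the
    vertices of [f(s)] lifts uniquely to one of [s], with the same sign
    ([sum_osign_lifts]). Finally [f^*] and [f_*] keep both degrees, hence the
    grading and the filtration, and a morphism of filtered complexes acts on every
    page of the spectral sequence ([induced_page_map]). *)

(** * Morphisms of filtered complexes *)

Lemma page_classP (C : filtered_complex) (r p n : int) (x y : Defs.cycle C r p n) :
  reflect (page_class x = page_class y) (x - y \in @boundary C r p n).
Proof. by rewrite Quotient.idealrBE; apply: eqP. Qed.

Section Pages.
Variables (C C' : filtered_complex) (F : {additive C -> C'}).
Hypothesis F_diff : forall x, F (diff C x) = diff C' (F x).
Hypothesis F_degree : forall n x, x \in degree C n -> F x \in degree C' n.
Hypothesis F_filt : forall p x, x \in filt C p -> F x \in filt C' p.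

Lemma morphism_cycles r p n x :
  x \in @cycles C r p n -> F x \in @cycles C' r p n.
Proof.
move=> /and3P[x1 x2 x3]; apply/and3P; split; [exact: F_degree|exact: F_filt|].
by rewrite -F_diff; apply: F_filt.
Qed.

Variables (r p n : int).

Definition cycle_map (x : Defs.cycle C r p n) : Defs.cycle C' r p n :=
  Cycle (morphism_cycles (valP x)).

Fact cycle_map_is_zmod_morphism : zmod_morphism cycle_map.
Proof. by move=> x y; apply: val_inj; rewrite /= raddfB. Qed.
HB.instance Definition _ := GRing.isZmodMorphism.Build _ _ cycle_map
  cycle_map_is_zmod_morphism.

Lemma cycle_map_boundary x : x \in @boundary C r p n ->
  cycle_map x \in @boundary C' r p n.
Proof.
move=> /asboolP[y [z [hy hz e]]]; apply/asboolP; exists (F y), (F z).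
split; [exact: morphism_cycles|exact: morphism_cycles|].
by rewrite -F_diff -raddfD -e.
Qed.

Definition page_map (a : page C r p n) : page C' r p n :=
  page_class (cycle_map (repr a)).

(** The action on a page does not depend on the representative chosen by [repr],
    since [F] maps boundaries of a page to boundaries. *)
Lemma page_map_class x : page_map (page_class x) = page_class (cycle_map x).
Proof.
apply/page_classP; rewrite -raddfB; apply: cycle_map_boundary.
by apply/page_classP; rewrite /page_class reprK.
Qed.

Fact page_map_is_zmod_morphism : zmod_morphism page_map.
Proof.
move=> a b; rewrite -[a]reprK -[b]reprK -[_ - _](raddfB (\pi)%qT).
by rewrite !page_map_class raddfB /page_class raddfB.
Qed.
HB.instance Definition _ := GRing.isZmodMorphism.Build _ _ page_map
  page_map_is_zmod_morphism.

Lemma induced_page_map :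
  exists phi : {additive page C r p n -> page C' r p n}, induces F phi.
Proof.
exists page_map => x; exists (cycle_map x); split=> //.
exact: page_map_class.
Qed.

End Pages.

(** * Simplices and their orientations under a vertex map *)

Lemma perm_map_lift (T T' : eqType) (f : T -> T') (s : seq T) (s' : seq T') :
  perm_eq s' (map f s) -> exists2 u, perm_eq u s & map f u = s'.
Proof.
case: s => [/perm_nilP->|a s /(perm_iotaP (f a))[I hI ->]]; first by exists [::].
rewrite size_map in hI; exists (map (nth a (a :: s)) I).
  by apply/(perm_iotaP a); exists I.
rewrite -map_comp; apply/eq_in_map => i.
by rewrite (perm_mem hI) mem_iota => /andP[_ hi]; rewrite (nth_map a).
Qed.

Section VertexMap.
Variables (S S' : finType) (f : S -> S').
Implicit Types (s t : seq S).

(** Orientation signs are read off the positions of vertices in [s], which an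
    injective map does not change. *)
Lemma orientation_map s t : {in s &, injective f} -> perm_eq s t ->
  orientation (map f s) (map f t) = orientation s t.
Proof.
move=> fI st; rewrite /orientation -map_comp; congr (_ ^+ inversions _).
apply/eq_in_map => a at_ /=; have as_ : a \in s by rewrite (perm_mem st).
elim: s fI as_ {st} => //= b s IH fI.
rewrite inE eq_sym; case: (eqVneq b a) => [->|ba] /= as_; first by rewrite eqxx.
case: eqP => [/fI e|_].
  by move: ba; rewrite e ?eqxx // inE ?eqxx ?as_ ?orbT.
by rewrite IH // => u v us vs; apply: fI; rewrite inE ?us ?vs orbT.
Qed.

(** An ordering [s'] of the vertices of [map f s] has exactly one lift to an
    ordering of the vertices of [s], and the lift differs from [s] by the
    permutation by which [s'] differs from [map f s]. Orderings of other simplices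
    over [s'] contribute [0]. *)
Lemma sum_osign_lifts s (s' : seq S') : {in s &, injective f} ->
  \sum_(u : (size s').-tuple S | map f u == s') osign u s = osign s' (map f s).
Proof.
move=> fI.
have [hp|nhp] := boolP (perm_eq s' (map f s)); last first.
  rewrite /osign (negPf nhp) big1 // => u /eqP e; case: ifP => // h.
  by case/negP: nhp; rewrite -e perm_map.
have [s0 s0s fs0] := perm_map_lift hp.
have sz : size s0 == size s' by rewrite -fs0 size_map.
rewrite (bigD1 (Tuple sz)) /= ?fs0 // big1 ?addr0 => [|u /andP[/eqP fu nu]].
  rewrite -fs0 /osign perm_map // s0s orientation_map // => a b.
  by rewrite !(perm_mem s0s); apply: fI.
rewrite /osign; case: ifP => // h; case/eqP: nu; apply: val_inj => /=.
apply: (inj_in_map fI); last by rewrite fu.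
  by apply/allP => a; rewrite (perm_mem h).
by apply/allP => a; rewrite (perm_mem s0s).
Qed.

Lemma vset_map s : [set v in map f s] = f @: [set v in s].
Proof.
apply/setP => v'; rewrite inE; apply/mapP/imsetP => -[v hv ->];
  by exists v; rewrite // inE in hv *.
Qed.

(** Used with the coefficients at [- (x) t], where the added vertex must lie in
    [t]; taken for [f] and for [id], it makes the coboundaries in [L] and in [K]
    sums over the same vertices. *)
Lemma cobd_map (G : zmodType) (c : seq S' -> G) s t :
  uniq t -> {in t &, injective f} ->
  (forall v', v' \notin map f t -> c (v' :: map f s) = 0) ->
  cobd c (map f s) = \sum_(v <- t) c (f v :: map f s).
Proof.
move=> ut fI c0; rewrite /cobd (bigID (mem (map f t))) /= [X in _ + X]big1 //.
by rewrite addr0 -big_uniq ?map_inj_in_uniq //= big_map.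
Qed.

Lemma del_map i s : del i (map f s) = map f (del i s).
Proof. by rewrite /del map_cat map_take map_drop. Qed.

End VertexMap.

(** * The evaluation pairing *)

Section Evaluation.
Variables (reduced : bool) (S : finType) (K : simplicial_complex S) (G : zmodType).
Implicit Types (x : N reduced K G) (y : N reduced K int) (s t : seq S).

Lemma evBl x x' y : ev (x - x') y = ev x y - ev x' y.
Proof.
rewrite /ev -sumrB; apply: eq_bigr => A _.
by rewrite -sumrB; apply: eq_bigr => B _; rewrite -mulrzBl.
Qed.

Lemma ev_neq0 x y : ev x y != 0 -> exists s t, x s t != 0 /\ y s t != 0.
Proof.
apply: contraNP => /forallNP h; rewrite /ev big1 // => A _; rewrite big1 // => B _.
have [->|xAB] := eqVneq (x (enum A) (enum B)) 0; first by rewrite mul0rz.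
have [->|yAB] := eqVneq (y (enum A) (enum B)) 0; first by rewrite mulr0z.
by case: (h (enum A)); exists (enum B).
Qed.

(** Reduces additive identities on integral cochains to the generators with
    coefficient [1], on which the pushforward is defined. *)
Lemma gen_mulz s t (m : int) :
  gen reduced K s t m = gen reduced K s t 1 *~ m.
Proof.
apply: N_eq => u v _; rewrite coefMz /= /gen_fun.
by case: ifP => _; rewrite ?mul0rz // !mulrzz mul1r mulrC.
Qed.

Lemma ev_genl s t (g : G) y : generator reduced K s t ->
  ev (gen reduced K s t g) y = g *~ y s t.
Proof.
move=> h; have /and4P[/andP[us _] /andP[ut _] _ _] := h.
rewrite {1}(gen_span y) [in RHS](gen_span y) raddf_sum Defs.coef_sum mulrz_sumr.
apply: eq_bigr => A _; rewrite raddf_sum Defs.coef_sum mulrz_sumr.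
apply: eq_bigr => B _; rewrite /= ev_gen.
case: (boolP (generator reduced K (enum A) (enum B))) => hAB; last first.
  by rewrite /gen_fun (negPf hAB) Defs.coef0 // mul0rz.
rewrite genE // /gen_fun hAB mulrzz -mulrzA (osignC _ us) (osignC _ ut).
by rewrite mulrC.
Qed.

End Evaluation.

(** * The pullback and the pushforward *)

Section Induced.
Variables (reduced : bool) (S S' : finType).
Variables (K : simplicial_complex S) (L : simplicial_complex S') (f : S -> S').
Implicit Types (s t : seq S).

Section Pullback.
Variable G : zmodType.
Implicit Type x : N reduced L G.

(** The map [f^*] read on coefficients; the cut-off to generators is needed
    since [f] may send sequences that span no simplex of [K] to simplices of [L]. *)
Definition pullback_fun x s t : G :=
  if generator reduced K s t then x (map f s) (map f t) else 0.

Fact pullback_is_chain x : pullback_fun x \in is_chain reduced K (G := G).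
Proof.
apply/asboolP; rewrite /pullback_fun; split=> [s t /negPf->//|t|s] u1 a b u2.
- rewrite (generator_perm _ _ (perm_swap u1 a b u2) (perm_refl t)).
  by case: ifP => _; rewrite ?oppr0 // !map_cat /= coef_altl.
- rewrite (generator_perm _ _ (perm_refl s) (perm_swap u1 a b u2)).
  by case: ifP => _; rewrite ?oppr0 // !map_cat /= coef_altr.
Qed.

Definition pullback x : N reduced K G := Chain (pullback_is_chain x).

Lemma pullbackE x s t : generator reduced K s t ->
  pullback x s t = x (map f s) (map f t).
Proof. by rewrite /= /pullback_fun => ->. Qed.

Fact pullback_is_zmod_morphism : zmod_morphism pullback.
Proof.
move=> x y; apply: N_eq => s t h; rewrite pullbackE //.
by rewrite [RHS]/(pullback x s t - pullback y s t) !pullbackE.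
Qed.
HB.instance Definition _ := GRing.isZmodMorphism.Build _ _ pullback
  pullback_is_zmod_morphism.

Lemma pullback_supported P x :
  x \in supported P -> pullback x \in supported P.
Proof.
move=> /asboolP hx; apply/asboolP => s t; rewrite /= /pullback_fun.
by case: ifP => [_ /hx|_]; rewrite ?size_map ?eqxx.
Qed.

End Pullback.

Section Pushforward.
Variable G : zmodType.
Implicit Type x : N reduced K G.

(** [f_*] is the transpose of [f^*], chains of [K] with coefficients in [G]
    being homomorphisms from integral cochains to [G]; so its properties reduce
    to those of [f^*]. *)
Definition pushforward_fun x (s' t' : seq S') : G :=
  ev x (pullback (gen reduced L s' t' (1 : int))).

Fact pushforward_is_chain x : pushforward_fun x \in is_chain reduced L (G := G).
Proof.
apply/asboolP; rewrite /pushforward_fun; split=> [s' t' h|t'|s'].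
- by rewrite gen_out // !raddf0.
- by move=> u1 a b u2; rewrite gen_altl !raddfN.
- by move=> u1 a b u2; rewrite gen_altr !raddfN.
Qed.

Definition pushforward x : N reduced L G := Chain (pushforward_is_chain x).

Fact pushforward_is_zmod_morphism : zmod_morphism pushforward.
Proof. by move=> x y; apply: N_eq => s' t' _; apply: evBl. Qed.
HB.instance Definition _ := GRing.isZmodMorphism.Build _ _ pushforward
  pushforward_is_zmod_morphism.

(** The transposition holds on generators by definition, and generators span. *)
Lemma ev_pushforward x y : ev (pushforward x) y = ev x (pullback y).
Proof.
rewrite {1}(gen_span y) [in RHS](gen_span y) !raddf_sum; apply: eq_bigr => A _.
rewrite !raddf_sum; apply: eq_bigr => B _ /=.
by rewrite ev_gen gen_mulz !raddfMz.
Qed.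

(** If the pairing of [x] with [f^*(s' (x) t')] is nonzero, some generator occurs
    in both, and those of [f^*(s' (x) t')] have the bidegree of [s' (x) t']. *)
Lemma pushforward_supported P x :
  x \in supported P -> pushforward x \in supported P.
Proof.
move=> /asboolP hx; apply/asboolP => s' t' /ev_neq0[s [t [/hx]]].
suff /pullback_supported/asboolP h : gen reduced L s' t' (1 : int) \in
    supported (fun a b => (a == size s') && (b == size t')).
  by move=> hP /h /andP[/eqP<- /eqP<-].
apply/asboolP => u w; rewrite /= /gen_fun; case: ifP; last by rewrite eqxx.
rewrite intz mulf_eq0 negb_or => _ /andP[/osign_neq0/perm_size-> /osign_neq0/perm_size->].
by rewrite !eqxx.
Qed.

End Pushforward.

Hypotheses (hf : simplicial_map K L f) (hnd : nondegenerate_map K f).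

Lemma simplex_inj t : oriented_simplex K t -> {in t &, injective f}.
Proof.
move=> /andP[_ /hnd /eqP/imset_injP fI] u v us vs.
by apply: fI; rewrite inE.
Qed.

Lemma oriented_simplex_map t : oriented_simplex K t -> oriented_simplex L (map f t).
Proof.
move=> h; have /andP[ut tK] := h; rewrite /oriented_simplex vset_map (hf tK) andbT.
by rewrite map_inj_in_uniq //; apply: simplex_inj.
Qed.

Lemma generator_map s t : generator reduced K s t ->
  generator reduced L (map f s) (map f t).
Proof.
move=> /and4P[os ot st r]; apply/and4P; split; try exact: oriented_simplex_map.
  by rewrite !vset_map imsetS.
by case: (s) r.
Qed.

(** The two sides are compared term by term. Adding a vertex to [s]: only vertices
    of [t] count, and a repetition in the image is one in [K]. Deleting a vertex
    [w] of [t]: if [f(s)] lies in [f(t) \ f(w)], then [w] is not in [s]. In both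
    cases the terms that are not generators vanish simultaneously. *)
Lemma Delta_pullback (G : zmodType) (x : N reduced L G) :
  pullback (Delta x) = Delta (pullback x).
Proof.
apply: N_eq => s t h; have /and4P[os ot st r] := h.
have /andP[us _] := os; have /andP[ut _] := ot; have fI := simplex_inj ot.
have /and4P[_ ot' _ r'] := generator_map h.
rewrite pullbackE // !Delta_eq // size_map; congr (_ + _ *~ _).
  rewrite (@cobd_map _ _ f _ _ s t) //; last first.
    move=> v' h' /=; apply: Defs.coef0; apply: contra h' => /and4P[_ _ + _].
    by move/subsetP/(_ v'); rewrite !inE eqxx; apply.
  rewrite -[s in RHS]map_id (@cobd_map _ _ id _ _ s t) ?map_id //; last first.
    move=> v h' /=; apply: (@Defs.coef0 _ _ _ _ (pullback x)).
    apply: contra h' => /and4P[_ _ + _].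
    by move/subsetP/(_ v); rewrite !inE eqxx; apply.
  apply: eq_big_seq => v vt.
  case: (boolP (generator reduced K (v :: s) t)) => hg; first by rewrite pullbackE.
  rewrite [RHS]Defs.coef0 // Defs.coef0 //; apply: contra hg => /and4P[/andP[hu _] _ _ _].
  have us' : uniq (v :: s).
    by rewrite /= us andbT; apply: contra (andP hu).1 => /map_f->.
  have st' : [set w in v :: s] \subset [set w in t].
    apply/subsetP => w; rewrite !inE => /predU1P[->//|ws].
    by move/subsetP: st => /(_ w); rewrite !inE; apply.
  by apply/and4P; split; rewrite ?orbT //; apply: oriented_simplex_sub ot.
rewrite /bd [in LHS]size_map; apply: eq_bigr => i _; congr (_ *~ _).
rewrite del_map.
case: (boolP (generator reduced K s (del i t))) => hg; first by rewrite pullbackE.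
rewrite [RHS]Defs.coef0 // Defs.coef0 //; apply: contra hg => /and4P[_ _ sub _].
apply/and4P; split=> //; first exact: oriented_simplex_subseq (del_subseq _ _) ot.
apply/subsetP => v; rewrite !inE => vs.
have vt : v \in t by move/subsetP: st => /(_ v); rewrite !inE; apply.
have : f v \in map f (del i t).
  by move/subsetP: sub => /(_ (f v)); rewrite !inE; apply; apply: map_f.
case/mapP => w wi /fI -> //; exact: mem_subseq (del_subseq _ _) _ wi.
Qed.

Section Coefficients.
Variable G : zmodType.

(** Moving everything to the integral side of the pairing turns this into
    [Delta_pullback]. *)
Lemma pushforward_D (x : N reduced K G) : pushforward (D x) = D (pushforward x).
Proof.
apply: N_eq => s' t' _.
rewrite -[LHS]mulr1z -[RHS]mulr1z -!ev_gen.
by rewrite ev_D !ev_pushforward ev_D Delta_pullback.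
Qed.

Lemma pushforward_gen s t (g : G) : generator reduced K s t ->
  pushforward (gen reduced K s t g) = gen reduced L (map f s) (map f t) g.
Proof.
move=> h; have h' := generator_map h.
have /and4P[/andP[us _] /andP[ut _] _ _] := h'.
apply: N_eq => s' t' hg.
rewrite [LHS](ev_genl _ _ h) pullbackE // !genE // mulrzz mul1r.
by rewrite (osignC _ us) (osignC _ ut).
Qed.

(** The coefficient of the right-hand side at [s (x) t] factors into two sums over
    lifts, one for [s'] and one for [t'], because the pairs of lifts that are not
    generators have coefficient [0] there. *)
Lemma pullback_gen (s' t' : seq S') (g : G) : generator reduced L s' t' ->
  pullback (gen reduced L s' t' g) =
    \sum_(s : (size s').-tuple S | map f s == s')
      \sum_(t : (size t').-tuple S | (map f t == t') && generator reduced K s t)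
        gen reduced K s t g.
Proof.
move=> h'; apply: N_eq => s t h; have /and4P[os ot _ _] := h.
rewrite pullbackE // genE // -!sum_osign_lifts; try exact: simplex_inj.
rewrite Defs.coef_sum mulr_suml mulrz_sumr; apply: eq_bigr => u _.
rewrite Defs.coef_sum mulr_sumr mulrz_sumr [RHS]big_mkcondr /=.
apply: eq_bigr => w _; case: ifPn => hg; first by rewrite /gen_fun hg.
have [->|] := eqVneq (osign u s * osign w t) 0; first by rewrite mulr0z.
rewrite mulf_eq0 negb_or => /andP[/osign_neq0 hu /osign_neq0 hw].
by rewrite (generator_perm _ _ hu hw) h in hg.
Qed.

End Coefficients.
End Induced.

Theorem theorem5p2 (S S' : finType) (K : simplicial_complex S)
    (L : simplicial_complex S') (G : zmodType) (f : S -> S')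
    (hf : simplicial_map K L f) (hnd : nondegenerate_map K f) (reduced : bool) :
  (exists f_ : {additive N reduced K G -> N reduced L G},
     (forall (s t : seq S) (g : G), generator reduced K s t ->
        f_ (gen reduced K s t g) = gen reduced L (map f s) (map f t) g) /\
     (forall p q : int,
        exists phi : {additive homeology reduced K G p q ->
                               homeology reduced L G p q},
          @induces (chain_complex reduced K G) (chain_complex reduced L G) f_
            2 (- p) (- (q - p)) phi)) /\
  (exists f_ : {additive N reduced L G -> N reduced K G},
     (forall (s' t' : seq S') (g : G), generator reduced L s' t' ->
        f_ (gen reduced L s' t' g) =
          \sum_(s : (size s').-tuple S | map f s == s')
            \sum_(t : (size t').-tuple S | (map f t == t') && generator reduced K s t)
              gen reduced K s t g) /\
     (forall p q : int,
        exists phi : {additive cohomeology reduced L G p q ->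
                               cohomeology reduced K G p q},
          @induces (cochain_complex reduced L G) (cochain_complex reduced K G) f_
            2 p (q - p) phi)).
Proof.
split.
  exists (@pushforward reduced S S' K L f G : {additive _ -> _}); split=> [s t g|p q].
    exact: pushforward_gen.
  apply: induced_page_map => [x|n x|i x].
  - exact: pushforward_D.
  - exact: pushforward_supported.
  - exact: pushforward_supported.
exists (@pullback reduced S S' K L f G : {additive _ -> _}); split=> [s' t' g|p q].
  exact: pullback_gen.
apply: induced_page_map => [x|n x|i x].
- exact: Delta_pullback.
- exact: pullback_supported.
- exact: pullback_supported.
Qed.
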